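(* Let $\mathbb{I}=\{\mathbb{I}_1,\dots,\mathbb{I}_N\}$ be a random iterated function system on a compact metric space $(K,d)$ (see context), and write $p=\sup_{u\in\Omega}\dim_{\mathrm P}F_u$. Assume there exists $v=(v_1,v_2,\dots)\in\Omega$ such that $\lim_{k\to\infty}\sum_{j_1\in\mathcal{I}_{v_1},\dots,j_k\in\mathcal{I}_{v_k}}\mathrm{Lip}^+(S_{v_1,j_1}\circ\cdots\circ S_{v_k,j_k})^p=0.$ Then: (1) if $\sup_{u\in\Omega}\mathcal{P}^p(F_u)=\infty$, then for a typical $\omega\in\Omega$, $\mathcal{P}^p(F_\omega)=\infty$; (2) if $\sup_{u\in\Omega}\mathcal{P}^p(F_u)<\infty$, then for a typical $\omega\in\Omega$, $\mathcal{P}^p(F_\omega)=0$.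
   Context: A random iterated function system on a compact metric space $(K,d)$ is a finite set $\mathbb{I}=\{\mathbb{I}_1,\dots,\mathbb{I}_N\}$ with $\mathbb{I}_i=\{S_{i,j}\}_{j\in\mathcal{I}_i}$, $\mathcal{I}_i$ finite nonempty, each $S_{i,j}:K\to K$ a bi-Lipschitz contraction: $0<\mathrm{Lip}^-(S_{i,j})\le\mathrm{Lip}^+(S_{i,j})<1$ where $\mathrm{Lip}^-(\phi)=\inf_{x\ne y}d(\phi x,\phi y)/d(x,y)$, $\mathrm{Lip}^+(\phi)=\sup_{x\ne y}d(\phi x,\phi y)/d(x,y)$. $\Omega=\{1,\dots,N\}^{\mathbb{N}}$ and for $\omega\in\Omega$, $F_\omega=\bigcap_k\bigcup_{i_1\in\mathcal{I}_{\omega_1},\dots,i_k\in\mathcal{I}_{\omega_k}}S_{\omega_1,i_1}\circ\cdots\circ S_{\omega_k,i_k}(K)$. $\Omega$ has the metric $d_\Omega(u,v)=2^{-\min\{n:u_n\ne v_n\}}$; ''typical $\omega$'' means the set of such $\omega$ is residual in $(\Omega,d_\Omega)$. $\mathcal{P}^s$ denotes $s$-dimensional packing measure (defined from the packing pre-measure using centred packings by closed balls, then $\mathcal{P}^s(F)=\inf\{\sum_i\mathcal{P}^s_0(F_i):F\subseteq\bigcup F_i\}$) and $\dim_{\mathrm P}$ packing dimension. *)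

(* Defs.v *)
From HB Require Import structures.
From mathcomp Require Import all_boot all_order all_algebra.
From mathcomp Require Import all_classical all_reals all_analysis.
Set Implicit Arguments. Unset Strict Implicit. Unset Printing Implicit Defensive.
Import Order.TTheory GRing.Theory Num.Theory.
Import numFieldNormedType.Exports.
Local Open Scope classical_set_scope.
Local Open Scope ring_scope.

Section Defs.
Variables (R : realType) (T : Type) (d : T -> T -> R).

Definition is_metric : Prop :=
  [/\ forall x y, 0 <= d x y,
      forall x y, d x y = 0 <-> x = y,
      forall x y, d x y = d y x &
      forall x y z, d x z <= d x y + d y z].

(** (T,d) is compact: sequentially compact (equivalent for metric spaces). *)
Definition seq_compact : Prop :=
  forall u : nat -> T, exists (phi : nat -> nat) (x : T),
    (forall n, (phi n < phi n.+1)%N) /\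
    (fun n => d (u (phi n)) x) @ \oo --> (0 : R).

Definition ratios (f : T -> T) : set (\bar R) :=
  [set r | exists x y, x <> y /\ r = (d (f x) (f y) / d x y)%:E].
Definition Lip_plus (f : T -> T) : \bar R := ereal_sup (ratios f).
Definition Lip_minus (f : T -> T) : \bar R := ereal_inf (ratios f).

Definition bilip_contraction (f : T -> T) : Prop :=
  (0 < Lip_minus f)%E /\ (Lip_minus f <= Lip_plus f)%E /\ (Lip_plus f < 1)%E.

(** Random IFS: N families; family i is {S i j | j < M i}. Omega = nat -> 'I_N
    (position n of the sequence corresponds to omega_{n+1} of the paper). *)
Variables (N : nat) (M : 'I_N -> nat) (S : 'I_N -> nat -> T -> T).

Definition is_RIFS : Prop :=
  (0 < N)%N /\ (forall i, (0 < M i)%N) /\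
  (forall i j, (j < M i)%N -> bilip_contraction (S i j)).

Fixpoint words (w : nat -> 'I_N) (n k : nat) : seq (seq nat) :=
  match k with
  | 0 => [:: [::]]
  | k.+1 => [seq j :: s | j <- iota 0 (M (w n)), s <- words w n.+1 k]
  end.

Fixpoint compw (w : nat -> 'I_N) (n : nat) (s : seq nat) : T -> T :=
  match s with
  | [::] => id
  | j :: s' => S (w n) j \o compw w n.+1 s'
  end.

Definition F (w : nat -> 'I_N) : set T :=
  \bigcap_(k in [set: nat])
    \bigcup_(s in [set s | s \in words w 0 k]) (compw w 0 s @` [set: T]).

Definition cball (x : T) (r : R) : set T := [set y | d x y <= r].

Definition packing_sums (s delta : R) (E : set T) : set (\bar R) :=
  [set z | exists (I : set nat) (x : nat -> T) (r : nat -> R),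
     [/\ forall i, I i -> E (x i) /\ 0 < r i /\ r i <= delta,
         forall i j, I i -> I j -> i <> j -> cball (x i) (r i) `&` cball (x j) (r j) = set0 &
         z = \esum_(i in I) (powR (2 * r i) s)%:E]].

Definition packing_premeasure_delta (s delta : R) (E : set T) : \bar R :=
  ereal_sup (packing_sums s delta E).

Definition packing_premeasure (s : R) (E : set T) : \bar R :=
  ereal_inf [set packing_premeasure_delta s delta E | delta in [set delta | 0 < delta]].

Definition packing_measure (s : R) (E : set T) : \bar R :=
  ereal_inf [set z | exists Fs : nat -> set T,
     E `<=` \bigcup_(i in [set: nat]) Fs i /\
     z = \esum_(i in [set: nat]) packing_premeasure s (Fs i)].

Definition packing_dim (E : set T) : \bar R :=
  ereal_inf [set s%:E | s in [set s : R | 0 <= s /\ packing_measure s E = 0%E]].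

End Defs.

Section Omega.
Variables (R : realType) (N : nat).

Definition dOmega (u v : nat -> 'I_N) : R :=
  sup [set (2 : R) ^- n.+1 | n in [set n | u n != v n]].

Definition Omega_open (A : set (nat -> 'I_N)) : Prop :=
  forall u, A u -> exists2 e : R, 0 < e & forall v, dOmega u v < e -> A v.

Definition Omega_dense (A : set (nat -> 'I_N)) : Prop :=
  forall u (e : R), 0 < e -> exists v, A v /\ dOmega u v < e.

Definition Omega_residual (A : set (nat -> 'I_N)) : Prop :=
  exists G : nat -> set (nat -> 'I_N),
    (forall n, Omega_open (G n) /\ Omega_dense (G n)) /\
    \bigcap_(n in [set: nat]) G n `<=` A.

Definition typical (P : (nat -> 'I_N) -> Prop) : Prop := Omega_residual [set w | P w].
End Omega.

(* Main.v *)
(** Every F_w is the union, over the words s of length k, of the copies f_s(F_(sigma^k w)),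
    where sigma is the shift on Omega.

    Finite supremum: if w starts with u_1 ... u_m v_1 ... v_k, then
    P^p(F_w) <= #{words of length m} * (sum of Lip^+(f_s)^p over the words of v_1 ... v_k) * sup P^p,
    which tends to 0 as k grows.  Hence the w such that P^p(F_w') < 1/n for all w' sharing
    a long enough prefix with w form a dense open set.

    Infinite supremum: w |-> P_(0,delta)^p(F_(sigma^k w)) is lower semicontinuous, because a
    finite packing survives a slight shrinking of its balls and a small displacement of their
    centres, and it takes arbitrarily large values near every point.  So for a typical w the
    premeasure P_0^p of every F_(sigma^k w), hence of every cylinder of F_w, is infinite.
    The premeasure of a set equals that of its closure, so by Baire's argument in F_w some set
    in any countable cover of F_w has infinite premeasure: P^p(F_w) is infinite. *)
Require Import Defs.
From HB Require Import structures.
From mathcomp Require Import all_boot all_order all_algebra.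
From mathcomp Require Import all_classical all_reals all_analysis.
Import Order.TTheory GRing.Theory Num.Theory.
Import numFieldNormedType.Exports.
Local Open Scope classical_set_scope.
Local Open Scope ring_scope.
From mathcomp Require Import lra.
Set Implicit Arguments. Unset Strict Implicit. Unset Printing Implicit Defensive.

(** * Sums of nonnegative extended reals *)

Section EsumNat.
Context {R : realType}.
Local Open Scope ereal_scope.

Lemma ge0_esumZl (I : choiceType) (A : set I) (a : I -> \bar R) (c : R) :
  (0 < c)%R -> (forall i, 0 <= a i) ->
  \esum_(i in A) (c%:E * a i) = c%:E * \esum_(i in A) a i.
Proof.
move=> c0 a0; rewrite /esum -ereal_sup_pZl//; congr ereal_sup.
apply/seteqP; split=> [_ [X AX <-]|_ [_ [X AX <-] <-]] /=.
  by exists (\sum_(x \in X) a x); [exists X | rewrite ge0_mule_fsumr].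
by exists X => //; rewrite ge0_mule_fsumr.
Qed.

(** Used to sum over a cover obtained by interleaving two countable covers. *)
Lemma esum_even_odd (a : nat -> \bar R) : (forall n, 0 <= a n) ->
  \esum_(n in [set: nat]) a n =
  \esum_(n in [set: nat]) a n.*2 + \esum_(n in [set: nat]) a n.*2.+1.
Proof.
move=> a0; rewrite (esumID [set n | ~~ odd n])// !setTI; congr (_ + _).
- rewrite -(esum_image [set: nat] double a) => [|m n _ _ /double_inj//].
  congr esum; apply/seteqP; split=> [n /= en|_ [n _ <-]/=].
    by exists n./2 => //=; rewrite even_halfK.
  by rewrite odd_double.
- rewrite -(esum_image [set: nat] (fun n => n.*2.+1) a); last first.
    by move=> m n _ _ [] /double_inj.
  congr esum; apply/seteqP; split=> [n /= /negP/negPn on|_ [n _ <-]/=].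
    by exists n./2 => //=; rewrite odd_halfK// prednK// odd_gt0.
  by rewrite odd_double.
Qed.

End EsumNat.

(** * Packing premeasure and packing measure: monotonicity, subadditivity, transfer along maps *)

Section Packing.
Context {R : realType} {T : Type} (d : T -> T -> R) (s : R) (t0 : T).
Implicit Types (E : set T) (f g : T -> T).
Local Open Scope ereal_scope.

Lemma packing_premeasure_delta_ge0 delta E :
  0 <= packing_premeasure_delta d s delta E.
Proof.
(* The empty packing; [t0] only fills in the centres off the empty index set. *)
apply: ereal_sup_ubound; exists set0, (fun=> t0), (fun=> 0%R).
by split=> //; rewrite esum_set0.
Qed.

Lemma le_packing_premeasure_delta delta delta' E E' :
  (delta <= delta')%R -> E `<=` E' ->
  packing_premeasure_delta d s delta E <= packing_premeasure_delta d s delta' E'.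
Proof.
move=> dd' EE'; apply: le_ereal_sup => z [I [x [r [h1 h2 ->]]]].
exists I, x, r; split=> // i /h1[/EE' ? [? rd]]; split=> //; split=> //.
exact: le_trans dd'.
Qed.

Lemma packing_premeasure_ge0 E : 0 <= packing_premeasure d s E.
Proof.
by apply: le_ereal_inf_tmp => _ [delta _ <-]; exact: packing_premeasure_delta_ge0.
Qed.

Lemma packing_premeasure0 : packing_premeasure d s set0 = 0.
Proof.
apply/eqP; rewrite eq_le packing_premeasure_ge0 andbT.
apply: (@le_trans _ _ (packing_premeasure_delta d s 1 set0)).
  by apply: ereal_inf_lbound; exists 1%R => //=.
apply: ge_ereal_sup => z [I [x [r [h1 _ ->]]]].
by rewrite esum1// => i /h1[].
Qed.

(** The values grow with [delta], so a sequence of scales suffices. This turns infinite premeasure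
    into countably many strict inequalities, the shape needed for a residual set. *)
Lemma packing_premeasure_pinftyP E :
  packing_premeasure d s E = +oo <->
  forall n : nat, n%:R%:E < packing_premeasure_delta d s (n.+1%:R^-1) E.
Proof.
split=> [Eoo n|h].
  apply: (@lt_le_trans _ _ (packing_premeasure d s E)); first by rewrite Eoo ltry.
  by apply: ereal_inf_lbound; exists (n.+1%:R^-1)%R => //=; rewrite invr_gt0 ltr0n.
apply/eqyP => A A0; apply: le_ereal_inf_tmp => _ [delta d0 <-].
(* With this [n], [n.+1] exceeds both [A] and [delta^-1]. *)
pose n := Num.truncn (A + delta^-1)%R.
have nA : (A + delta^-1 < n.+1%:R)%R by exact: truncnS_gt.
have d'0 : (0 < delta^-1)%R by rewrite invr_gt0.
apply: (@le_trans _ _ n.+1%:R%:E).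
  by rewrite lee_fin ltW// (le_lt_trans _ nA)// lerDl ltW.
apply: (le_trans (ltW (h n.+1))).
apply: le_packing_premeasure_delta => //.
rewrite -[leRHS]invrK lef_pV2 ?posrE ?ltr0n//.
by rewrite ltW// (lt_trans _ (_ : n.+1%:R < _)%R) ?ltr_nat// (le_lt_trans _ nA)// lerDr ltW.
Qed.

Lemma packing_measure_ge0 E : 0 <= packing_measure d s E.
Proof.
apply: le_ereal_inf_tmp => _ [Fs [_ ->]].
by apply: esum_ge0 => i _; exact: packing_premeasure_ge0.
Qed.

Lemma le_packing_measure E E' :
  E `<=` E' -> packing_measure d s E <= packing_measure d s E'.
Proof.
move=> EE'; apply: le_ereal_inf => z [Fs [E'F ->]].
by exists Fs; split=> //; exact: subset_trans E'F.
Qed.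

Lemma packing_measure_le_premeasure E :
  packing_measure d s E <= packing_premeasure d s E.
Proof.
apply: ereal_inf_lbound; exists (fun n => if n is 0%N then E else set0); split.
  by move=> x Ex; exists 0%N.
rewrite (esumID [set 0%N])//=; last by move=> *; exact: packing_premeasure_ge0.
rewrite !setTI esum_set1 ?packing_premeasure_ge0// esum1 ?adde0//.
by case=> [|n]/= n0; rewrite ?packing_premeasure0.
Qed.

Lemma packing_measure0 : packing_measure d s set0 = 0.
Proof.
apply/eqP; rewrite eq_le packing_measure_ge0 andbT -packing_premeasure0.
exact: packing_measure_le_premeasure.
Qed.

Lemma packing_measureU E E' :
  packing_measure d s (E `|` E') <= packing_measure d s E + packing_measure d s E'.
Proof.
rewrite /packing_measure.
set A := [set z | _]; set B := [set z | _]; set C := [set z | _].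
have P0 := packing_premeasure_ge0.
apply/lee_addgt0Pr => e e0.
(* An infinite infimum makes the bound trivial; finite ones have covers [G] and [H] that are optimal
   up to [e / 2]. *)
have [] := pselect (ereal_inf B < +oo /\ ereal_inf C < +oo); last first.
  move=> /not_andP[] /negP; rewrite -leNgt leye_eq => /eqP ->.
    by rewrite addye// ?addey ?leey// gt_eqF// (lt_le_trans _ (packing_measure_ge0 _)).
  by rewrite addey// ?addye ?leey// gt_eqF// (lt_le_trans _ (packing_measure_ge0 _)).
move=> [Boo Coo].
have e2 : (0 < e / 2)%R by rewrite divr_gt0.
have fB : ereal_inf B \is a fin_num.
  by rewrite ge0_fin_numE//; exact: packing_measure_ge0.
have fC : ereal_inf C \is a fin_num.
  by rewrite ge0_fin_numE//; exact: packing_measure_ge0.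
have [_ [G [EG ->]] Ge] := lb_ereal_inf_adherent e2 fB.
have [_ [H [EH ->]] He] := lb_ereal_inf_adherent e2 fC.
rewrite (splitr e) EFinD addeACA; apply: le_trans (leeD (ltW Ge) (ltW He)).
apply: ereal_inf_lbound.
(* The two covers are interleaved: [G] at even indices, [H] at odd ones. *)
exists (fun n => if odd n then H n./2 else G n./2); split.
  move=> x [/EG[n _ Gn]|/EH[n _ Hn]].
    by exists n.*2 => //=; rewrite odd_double doubleK.
  by exists n.*2.+1 => //=; rewrite odd_double/= uphalf_double.
rewrite [RHS]esum_even_odd; last by move=> n; exact: P0.
congr (_ + _)%E; apply: eq_esum => n _.
  by rewrite odd_double doubleK.
by rewrite oddS odd_double/= uphalf_double.
Qed.

Lemma packing_measure_bigcup_seq (I : eqType) (r : seq I) (G : I -> set T) :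
  packing_measure d s (\bigcup_(i in [set i | i \in r]) G i) <=
  \sum_(i <- r) packing_measure d s (G i).
Proof.
elim: r => [|i r IH]; rewrite ?big_nil ?big_cons.
  rewrite (_ : bigcup _ _ = set0) ?packing_measure0//.
  by apply/seteqP; split=> x // [].
apply: le_trans (leeD (le_refl _) IH); apply: le_trans (packing_measureU _ _).
apply: le_packing_measure => x [j /=]; rewrite inE => /orP[/eqP->|jr] Gx.
  by left.
by right; exists j.
Qed.

(** Scaling the radii by [k] scales each term of a packing sum by [k] to the power [s]. Only
    disjointness of the scaled balls is asked of [g], so that [g] may be an expanding map or a
    section of a Lipschitz map. *)
Lemma packing_premeasure_delta_transfer (g : T -> T) (k : R) delta E E' :
  (0 < k)%R -> (forall x, E x -> E' (g x)) ->
  (forall x y r r', E x -> E y -> (0 < r)%R -> (0 < r')%R ->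
    cball d x r `&` cball d y r' = set0 ->
    cball d (g x) (k * r) `&` cball d (g y) (k * r') = set0) ->
  (powR k s)%:E * packing_premeasure_delta d s delta E <=
  packing_premeasure_delta d s (k * delta) E'.
Proof.
move=> k0 gE gdis; rewrite /packing_premeasure_delta -ereal_sup_pZl ?powR_gt0//.
apply: ge_ereal_sup => _ [_ [I [x [r [h1 h2 ->]]] <-]].
rewrite -ge0_esumZl ?powR_gt0//; last by move=> i; rewrite lee_fin powR_ge0.
apply: ereal_sup_ubound; exists I, (g \o x), (fun i => k * r i)%R; split.
- move=> i /h1[Exi [ri rd]]; split; first exact: gE.
  by rewrite mulr_gt0// ler_pM2l.
- move=> i j Ii Ij ij; have [? [? _]] := h1 _ Ii; have [? [? _]] := h1 _ Ij.
  by apply: gdis => //; exact: h2.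
- apply: eq_esum => i /h1[_ [ri _]].
  by rewrite -EFinM -powRM ?(ltW k0)// ?mulr_ge0 ?(ltW ri)// mulrCA.
Qed.

Lemma packing_premeasure_transfer (g : T -> T) (k : R) E E' :
  (0 < k)%R -> (forall x, E x -> E' (g x)) ->
  (forall x y r r', E x -> E y -> (0 < r)%R -> (0 < r')%R ->
    cball d x r `&` cball d y r' = set0 ->
    cball d (g x) (k * r) `&` cball d (g y) (k * r') = set0) ->
  (powR k s)%:E * packing_premeasure d s E <= packing_premeasure d s E'.
Proof.
move=> k0 gE gdis; apply: le_ereal_inf_tmp => _ [delta d0 <-].
have kn0 : k != 0%R by rewrite gt_eqF.
(* Radii at most [delta] in [E'] come from radii at most [k^-1 * delta] in [E]. *)
rewrite -[delta](mulVKf kn0).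
apply: le_trans (packing_premeasure_delta_transfer _ k0 gE gdis).
rewrite lee_wpmul2l ?lee_fin ?powR_ge0//; apply: ereal_inf_lbound.
by exists (k^-1 * delta)%R => //=; rewrite mulr_gt0// invr_gt0.
Qed.

(** [Phi] carries covers of [E'] to covers of [E]: it will be a direct image for upper bounds on the
    measure of an image, a preimage for lower bounds. *)
Lemma packing_measure_transfer (Phi : set T -> set T) (c : R) E E' :
  (0 < c)%R ->
  (forall G : nat -> set T, E' `<=` \bigcup_i G i -> E `<=` \bigcup_i Phi (G i)) ->
  (forall G, c%:E * packing_premeasure d s (Phi G) <= packing_premeasure d s G) ->
  c%:E * packing_measure d s E <= packing_measure d s E'.
Proof.
move=> c0 cov Phile; apply: le_ereal_inf_tmp => _ [G [E'G ->]].
apply: (@le_trans _ _ (c%:E * \esum_(i in [set: nat]) packing_premeasure d s (Phi (G i)))).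
  rewrite lee_wpmul2l ?lee_fin ?(ltW c0)//; apply: ereal_inf_lbound.
  by exists (Phi \o G); split=> //; exact: cov.
rewrite -ge0_esumZl//; last by move=> i; exact: packing_premeasure_ge0.
exact: le_esum.
Qed.

End Packing.

Section MetricSpace.
Context {R : realType} {T : Type} (d : T -> T -> R).
Hypothesis dP : is_metric d.

Lemma dist_ge0 x y : 0 <= d x y. Proof. by case: dP. Qed.

Lemma distxx x : d x x = 0. Proof. by case: dP => _ h _ _; apply/h. Qed.

Lemma distC x y : d x y = d y x. Proof. by case: dP. Qed.

Lemma dist_triangle z x y : d x y <= d x z + d z y.
Proof. by case: dP. Qed.

Lemma dist_gt0 x y : x <> y -> 0 < d x y.
Proof.
move=> xy; rewrite lt_neqAle dist_ge0 andbT eq_sym; apply/eqP => d0.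
by apply: xy; case: dP => _ h _ _; apply/h.
Qed.

(** * Packing measure under Lipschitz and expanding maps *)

Section Lipschitz.
Variables (s : R) (t0 : T) (f : T -> T).

(** Choosing preimages of the centres pulls a packing of the image back, with radii divided by [b]:
    a common point of two pulled-back balls would be sent by [f] into both original balls. *)
Lemma packing_measure_image_le (b : R) (E : set T) :
  0 < b -> (forall x y, d (f x) (f y) <= b * d x y) ->
  (packing_measure d s (f @` E) <= (b `^ s)%:E * packing_measure d s E)%E.
Proof.
move=> b0 flip; have bn0 : b != 0 by rewrite gt_eqF.
have -> : b `^ s = (b^-1 `^ s)^-1
  by rewrite -powRN -powR_inv1 ?ltW// -powRrM mulrN mulNr opprK mul1r.
have bV0 : 0 < b^-1 `^ s by rewrite powR_gt0// invr_gt0.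
rewrite lee_pdivlMl//; apply: (packing_measure_transfer t0 (Phi := image^~ f)) => //.
  by move=> G EG _ [x /EG[i _ Gx] <-]; exists i => //; exists x.
move=> G.
have [y|g gP] := @choice _ _ (fun y x => (f @` G) y -> G x /\ f x = y).
  have [[x Gx fx]|nGy] := pselect ((f @` G) y).
    by exists x.
  by exists t0.
apply: (@packing_premeasure_transfer _ _ d s g); first by rewrite invr_gt0.
  by move=> x /gP[].
move=> x y r r' /gP[_ gx] /gP[_ gy] _ _ xy0; apply/eqP/negPn/negP => /set0P[z [zx zy]].
have : (cball d x r `&` cball d y r') (f z).
  split; rewrite /cball/= -1?[x in d x _]gx -1?[y in d y _]gy;
  by rewrite (le_trans (flip _ _))// -ler_pdivlMl.
by rewrite xy0.
Qed.

Variable a : R.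
Hypotheses (a0 : 0 < a) (fexp : forall x y, a * d x y <= d (f x) (f y)).

(* Injectivity of [f] does not make the balls around [f x] and [f y] disjoint,
   since they may meet outside the image of [f]; the factor 1/2 takes care of it. *)
Let shrunk_balls_disjoint x y r r' : 0 < r -> 0 < r' ->
  cball d x r `&` cball d y r' = set0 ->
  cball d (f x) (a / 2 * r) `&` cball d (f y) (a / 2 * r') = set0.
Proof.
move=> r0 r'0 xy0; apply/eqP/negPn/negP => /set0P[z [/= zx zy]].
(* Hence the centre of the ball with the smaller radius lies in the other ball too. *)
have xyr : d x y <= (r + r') / 2.
  rewrite -(ler_pM2l a0) (le_trans (fexp _ _))// (le_trans (dist_triangle z _ _))//.
  by rewrite (distC z) (le_trans (lerD zx zy))// -mulrDr mulrAC -mulrA.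
have [rr'|r'r] := leP r r'.
- have : (cball d x r `&` cball d y r') x.
    split; rewrite /cball/= ?distxx ?(ltW r0)// distC (le_trans xyr)//.
    by rewrite ler_pdivrMr// mulr_natr mulr2n lerD2r.
  by rewrite xy0.
- have : (cball d x r `&` cball d y r') y.
    split; rewrite /cball/= ?distxx ?(ltW r'0)// (le_trans xyr)//.
    by rewrite ler_pdivrMr// mulr_natr mulr2n lerD2l ltW.
  by rewrite xy0.
Qed.

Lemma packing_premeasure_image_ge (E E' : set T) : (forall x, E x -> E' (f x)) ->
  (((a / 2) `^ s)%:E * packing_premeasure d s E <= packing_premeasure d s E')%E.
Proof.
move=> EE'; apply: (@packing_premeasure_transfer _ _ d s f) => //.
  by rewrite divr_gt0.
by move=> x y r r' _ _; exact: shrunk_balls_disjoint.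
Qed.

Lemma packing_measure_image_ge (E : set T) :
  (((a / 2) `^ s)%:E * packing_measure d s E <= packing_measure d s (f @` E))%E.
Proof.
apply: (packing_measure_transfer t0 (Phi := preimage f)).
- by rewrite powR_gt0// divr_gt0.
- by move=> G EG x Ex; have [|i _ Gx] := EG (f x); [exists x | exists i].
- by move=> G; exact: packing_premeasure_image_ge.
Qed.

End Lipschitz.

(** * Lower semicontinuity of packing premeasures *)

Section Approximation.
Variables (s : R).
Hypothesis s0 : 0 <= s.

(** Provides a shrinking factor for the radii that costs at most a factor [t] in the packing sum. *)
Lemma exists_powR_gt (t : R) : 0 < t < 1 -> exists2 l : R, 0 < l < 1 & t <= l `^ s.
Proof.
move=> /andP[t0 t1]; move: s0; rewrite le_eqVlt => /orP[/eqP <-|sgt0].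
  (* For exponent 0 every factor works, since its power is 1. *)
  by exists (2^-1); rewrite ?invr_gt0 ?ltr0n ?invf_lt1 ?ltr1n// powRr0 ltW.
exists (t `^ s^-1); last by rewrite -powRrM mulVf ?gt_eqF// powRr1// ltW.
rewrite powR_gt0//=.
have := @gt0_ltr_powR _ s^-1; rewrite invr_gt0 => /(_ sgt0 t 1).
by rewrite powR1; apply => //; rewrite nnegrE// ltW.
Qed.

Lemma exists_pos_le (I : eqType) (A : seq I) (f : I -> R) :
  (forall i, i \in A -> 0 < f i) -> exists2 e, 0 < e & forall i, i \in A -> e <= f i.
Proof.
elim: A => [|i A IH] fp; first by exists 1.
have [j jA|e e0 he] := IH; first by apply: fp; rewrite inE jA orbT.
exists (Num.min (f i) e); first by rewrite lt_min e0 fp// mem_head.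
by move=> j; rewrite inE ge_min => /orP[/eqP->|/he ->]; rewrite ?lexx ?orbT.
Qed.

(* A finite subpacking already has large sum, and survives a slight shrinking of
   its balls, which leaves room for moving their centres. *)
Lemma packing_premeasure_delta_lsc (c delta : R) (E : set T) : 0 <= c ->
  (c%:E < packing_premeasure_delta d s delta E)%E ->
  exists2 e : R, 0 < e & forall E' : set T,
    (forall x, E x -> exists2 y, E' y & d x y < e) ->
    (c%:E < packing_premeasure_delta d s delta E')%E.
Proof.
move=> c0 /ereal_sup_gt[_ [I [x [r [h1 h2 ->]]]]] /ereal_sup_gt[_ [X [finX XI] <-]].
rewrite fsumEFin// lte_fin; set Q := \sum_(i \in X) _ => cQ.
have Q0 : 0 < Q by exact: le_lt_trans cQ.
(* With this ratio the shrunk packing keeps a sum of at least the midpoint of [c] and [Q]. *)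
have [|l /andP[l0 l1] tl] := @exists_powR_gt ((c + Q) / 2 / Q).
  rewrite !divr_gt0 ?ltr_wpDl//= ltr_pdivrMr// mul1r ltr_pdivrMr//.
  by rewrite mulr_natr mulr2n ltrD2r.
have clQ : c < l `^ s * Q.
  apply: (@lt_le_trans _ _ ((c + Q) / 2)); last by rewrite -ler_pdivrMr.
  by rewrite ltr_pdivlMr// mulr_natr mulr2n ltrD2l.
have [A XA] := (finite_seqP X).1 finX.
(* [(1 - l) * r i] is how far the centre can move with the shrunk ball staying inside the original
   one. *)
have [i|e e0 he] := @exists_pos_le _ A (fun i => (1 - l) * r i).
  move=> iA; have /XI/h1[_ [ri _]] : X i by rewrite XA.
  by rewrite mulr_gt0// subr_gt0.
exists e => // E' EE'.
have [i|x' x'P] := @choice _ _ (fun i y => X i -> E' y /\ d (x i) y < e).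
  have [Xi|nXi] := pselect (X i); last by exists (x i).
  by have /XI/h1[/EE'[y E'y xy] _] := Xi; exists y.
apply: (@lt_le_trans _ _ (\esum_(i in X) (powR (2 * (l * r i)) s)%:E)%E).
  rewrite esum_fset//; last by move=> i _; rewrite lee_fin powR_ge0.
  rewrite fsumEFin// lte_fin; apply: (lt_le_trans clQ).
  rewrite le_eqVlt; apply/orP; left; apply/eqP.
  rewrite /Q !fsbig_finite//= mulr_sumr !big_seq; apply: eq_bigr => i.
  rewrite in_fset_set// inE => /XI/h1[_ [ri _]].
  by rewrite -powRM ?mulr_ge0 ?(ltW l0) ?(ltW ri)// mulrCA.
apply: ereal_sup_ubound; exists X, x', (fun i => l * r i); split=> //.
- move=> i /[dup] Xi /XI/h1[_ [ri rd]]; have [? _] := x'P _ Xi.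
  split=> //; split; first by rewrite mulr_gt0.
  by rewrite (le_trans _ rd)// ger_pMl// ltW.
- have sub i : X i -> cball d (x' i) (l * r i) `<=` cball d (x i) (r i).
    move=> Xi z; rewrite /cball/= => zi; have [_ xx'] := x'P _ Xi.
    rewrite (le_trans (dist_triangle (x' i) _ _))//.
    have : e <= (1 - l) * r i by apply: he; move: Xi; rewrite XA.
    rewrite mulrBl mul1r lerBrDr => h; apply: le_trans h.
    by rewrite lerD// ltW.
  move=> i j Xi Xj ij; apply/seteqP; split=> // z [zi zj].
  have : (cball d (x i) (r i) `&` cball d (x j) (r j)) z by split; exact: sub.
  by rewrite h2//; exact: XI.
Qed.

(** At each scale, semicontinuity at [E] applies to [E'] whatever tolerance it yields, so [E']
    exceeds every value below that of [E]. *)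
Lemma packing_premeasure_adherence (t0 : T) (E E' : set T) :
  (forall x e, E x -> 0 < e -> exists2 y, E' y & d x y < e) ->
  (packing_premeasure d s E <= packing_premeasure d s E')%E.
Proof.
move=> EE'; apply: le_ereal_inf_tmp => _ [delta d0 <-].
apply: (@le_trans _ _ (packing_premeasure_delta d s delta E)).
  by apply: ereal_inf_lbound; exists delta.
rewrite leNgt; apply/negP => lt.
have := packing_premeasure_delta_ge0 d s t0 delta E'.
case E'c : (packing_premeasure_delta d s delta E') lt => [c| |]// lt;
  last by rewrite ltNge leey in lt.
rewrite lee_fin => c0.
have [e e0 he] := packing_premeasure_delta_lsc c0 lt.
by have := he E' (fun x Ex => EE' x e Ex e0); rewrite E'c ltxx.
Qed.

End Approximation.

(** * Consequences of sequential compactness *)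

Section Compactness.
Hypothesis dK : seq_compact d.

Lemma seq_compact_subseq (u : nat -> T) : exists phi : nat -> nat, exists x : T,
  (forall n, (n <= phi n)%N) /\
  forall e, 0 < e -> exists m, forall n, (m <= n)%N -> d (u (phi n)) x < e.
Proof.
have [phi [x [phiS cx]]] := dK u; exists phi, x; split.
  elim=> // n IH; exact: leq_ltn_trans (phiS n).
move=> e e0; have /cvgrPdist_lt/(_ _ e0)[m _ hm] := cx.
exists m => n /hm /=; rewrite sub0r normrN ger0_norm//; exact: dist_ge0.
Qed.

Lemma seq_compact_bounded (t0 : T) : exists2 D : R, 0 < D & forall x y, d x y <= D.
Proof.
suff [D hD] : exists D : R, forall y, d t0 y <= D.
  exists (D + D + 1) => [|x y].
    by rewrite ltr_wpDl// addr_ge0// (le_trans _ (hD t0))// dist_ge0.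
  rewrite (le_trans (dist_triangle t0 _ _))// (distC x).
  by rewrite (le_trans (lerD (hD _) (hD _)))// lerDl.
apply: contrapT => /forallNP nD.
have [n|u uP] := @choice _ _ (fun (n : nat) y => n%:R < d t0 y).
  have /existsNP[y /negP] := nD n%:R.
  by rewrite -ltNge; exists y.
have [phi [x [phile /(_ _ ltr01)[m hm]]]] := seq_compact_subseq u.
(* At this index the subsequence is within 1 of [x], yet farther than [d t0 x + 1] from [t0]. *)
pose n := maxn m (Num.truncn (d t0 x + 1)).+1.
have := hm n (leq_maxl _ _); have := uP (phi n).
have : (d t0 x + 1 < n%:R).
  by rewrite (lt_le_trans (truncnS_gt _))// ler_nat leq_maxr.
have : (n%:R : R) <= (phi n)%:R by rewrite ler_nat.
have := dist_triangle x t0 (u (phi n)); rewrite (distC x (u _)).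
set X := d t0 _; set Y := d t0 _; set Z := d _ _; lra.
Qed.

(** Points whose images tend to [x] have a convergent subsequence, and continuity of [f] sends its
    limit to [x]. *)
Lemma closed_image (f : T -> T) (a b : R) (x : T) : 0 < a -> 0 < b ->
  (forall x y, a * d x y <= d (f x) (f y)) -> (forall x y, d (f x) (f y) <= b * d x y) ->
  (forall e, 0 < e -> exists y, d (f y) x < e) -> exists y, f y = x.
Proof.
move=> a0 b0 fa fb h.
have [n|u uP] := @choice _ _ (fun (n : nat) y => d (f y) x < n.+1%:R^-1).
  by apply: h; rewrite invr_gt0.
have [phi [y [phile hy]]] := seq_compact_subseq u.
exists y; apply: contrapT => /dist_gt0 fyx.
have e0 : 0 < d (f y) x / 2 / b by rewrite !divr_gt0.
have [m hm] := hy _ e0.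
(* Large enough that [f (u (phi n))] is closer than half of [d (f y) x] to both [f y] and [x], which
   is absurd. *)
pose n := maxn m (Num.truncn (d (f y) x / 2)^-1).
have h1 : d (f y) (f (u (phi n))) < d (f y) x / 2.
  rewrite (le_lt_trans (fb _ _))// -ltr_pdivlMl// mulrC distC.
  by apply: hm; exact: leq_maxl.
have h2 : d (f (u (phi n))) x < d (f y) x / 2.
  rewrite (lt_le_trans (uP _))// invf_ple ?posrE ?divr_gt0//.
  rewrite (le_trans (ltW (truncnS_gt _)))// ler_nat ltnS.
  by rewrite (leq_trans (leq_maxr m _))// phile.
have := dist_triangle (f (u (phi n))) (f y) x.
by rewrite leNgt (lt_le_trans (ltrD h1 h2))// -splitr.
Qed.

End Compactness.
End MetricSpace.

(** * Shifts, common prefixes, words and cylinders *)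

Definition shiftn {X : Type} (k : nat) (w : nat -> X) : nat -> X := fun n => w (k + n)%N.

Definition agree {X : Type} (k : nat) (w w' : nat -> X) : Prop :=
  forall i, (i < k)%N -> w i = w' i.

Section Words.
Context {N : nat} (M : 'I_N -> nat).
Implicit Types w : nat -> 'I_N.

Lemma mem_wordsS w n k (s : seq nat) : s \in words M w n k.+1 <->
  exists j t, [/\ (j < M (w n))%N, t \in words M w n.+1 k & s = j :: t].
Proof.
split=> [/allpairsP[[j t] [/=]]|[j [t [jM tw ->]]]].
  by rewrite mem_iota add0n => jM tw ->; exists j, t.
by apply/allpairsP; exists (j, t); rewrite mem_iota add0n.
Qed.

Lemma words_shiftn w m n k : words M (shiftn m w) n k = words M w (m + n) k.
Proof. by elim: k n => //= k IH n; rewrite IH addnS. Qed.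

Lemma size_words w n k (s : seq nat) : s \in words M w n k -> size s = k.
Proof.
elim: k n s => [|k IH] n s; first by rewrite inE => /eqP ->.
by move=> /mem_wordsS[j [t [_ /IH <- ->]]].
Qed.

Lemma words_cat w n k m (s t : seq nat) :
  s \in words M w n k -> t \in words M w (n + k) m -> s ++ t \in words M w n (k + m).
Proof.
elim: k n s => [|k IH] n s; first by rewrite inE addn0 => /eqP ->.
move=> /mem_wordsS[j [u [jM uw ->]]]; rewrite addnS -addSn => tw.
by rewrite cat_cons addSn; apply/mem_wordsS; exists j, (u ++ t); split=> //; exact: IH.
Qed.

Lemma words_split w n k m (s : seq nat) : s \in words M w n (k + m) ->
  exists s1 s2, [/\ s1 \in words M w n k, s2 \in words M w (n + k) m & s = s1 ++ s2].
Proof.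
elim: k n s => [|k IH] n s sw; first by exists [::], s; rewrite addn0; split.
move: sw; rewrite addSn => /mem_wordsS[j [t [jM /IH[s1 [s2 [h1 h2 ->]]] ->]]].
exists (j :: s1), s2; split=> //; last by rewrite addnS -addSn.
by apply/mem_wordsS; exists j, s1.
Qed.

Lemma words_agree w w' k : agree k w w' -> words M w 0 k = words M w' 0 k.
Proof.
(* The starting position is generalised because the recursion of [words] advances it. *)
suff h n m : (forall i, (i < m)%N -> w (n + i)%N = w' (n + i)%N) ->
    words M w n m = words M w' n m by move=> ww'; apply: h.
elim: m n => //= m IH n ww'; rewrite (IH n.+1) => [|i im]; last by rewrite addSnnS ww'.
by have := ww' 0%N isT; rewrite addn0 => ->.
Qed.

Lemma nseq0_words w n k : (forall i, (0 < M i)%N) -> nseq k 0%N \in words M w n k.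
Proof.
move=> M0; elim: k n => // k IH n.
by apply/mem_wordsS; exists 0%N, (nseq k 0%N); split.
Qed.

Context {T : Type} (S : 'I_N -> nat -> T -> T).

Lemma compw_shiftn w m n (s : seq nat) : compw S (shiftn m w) n s = compw S w (m + n) s.
Proof. by elim: s n => //= j s IH n; rewrite IH addnS. Qed.

Lemma compw_cat w n (s t : seq nat) (x : T) :
  compw S w n (s ++ t) x = compw S w n s (compw S w (n + size s) t x).
Proof. by elim: s n => [|j s IH] n /=; rewrite ?addn0// IH addSnnS. Qed.

Lemma compw_agree w w' (s : seq nat) :
  agree (size s) w w' -> compw S w 0 s = compw S w' 0 s.
Proof.
suff h n : (forall i, (i < size s)%N -> w (n + i)%N = w' (n + i)%N) ->
    compw S w n s = compw S w' n s by move=> ww'; apply: h.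
elim: s n => //= j s IH n ww'; rewrite (IH n.+1) => [|i im]; last by rewrite addSnnS ww'.
by have := ww' 0%N isT; rewrite addn0 => ->.
Qed.

Definition cylinder w (s : seq nat) : set T := compw S w 0 s @` [set: T].

Lemma cylinder_cat w (s t : seq nat) : cylinder w (s ++ t) `<=` cylinder w s.
Proof. by move=> _ [x _ <-]; rewrite compw_cat; exists (compw S w (0 + size s) t x). Qed.

Definition level w k : set T :=
  \bigcup_(s in [set s | s \in words M w 0 k]) cylinder w s.

Lemma level_le w k m : (k <= m)%N -> level w m `<=` level w k.
Proof.
move=> /subnKC <- x [_ /= /words_split[s [t [sw _ ->]]] /cylinder_cat xs].
by exists s.
Qed.

Lemma F_level w x : F M S w x <-> forall k, level w k x.
Proof. by split=> [Fx k|h k _]; [exact: Fx | exact: h]. Qed.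

End Words.

(** * Real Lipschitz constants extracted from the extended real ones *)

Section LipschitzConstants.
Context {R : realType} {T : Type} (d : T -> T -> R).
Hypothesis dP : is_metric d.

(** The pair [x0], [y0] keeps the set of ratios nonempty, so its supremum lies between [a] and
    [b]. *)
Lemma Lip_plus_fin (f : T -> T) (x0 y0 : T) (a b : R) : x0 <> y0 -> 0 < a ->
  (forall x y, a * d x y <= d (f x) (f y)) ->
  (forall x y, d (f x) (f y) <= b * d x y) ->
  exists L : R, [/\ 0 < L, Lip_plus d f = L%:E &
    forall x y, d (f x) (f y) <= L * d x y].
Proof.
move=> xy0 a0 fa fb.
have ratio x y : x <> y -> (a%:E <= (d (f x) (f y) / d x y)%:E <= Lip_plus d f)%E.
  move=> xy; rewrite lee_fin ler_pdivlMr ?dist_gt0// fa/=.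
  by apply: ereal_sup_ubound; exists x, y.
have Lb : (Lip_plus d f <= b%:E)%E.
  apply: ge_ereal_sup => _ [x [y [xy ->]]].
  by rewrite lee_fin ler_pdivrMr ?dist_gt0.
have La : (a%:E <= Lip_plus d f)%E by have /andP[/le_trans] := ratio _ _ xy0; apply.
case: (Lip_plus d f) La Lb ratio => [L| |]//; rewrite lee_fin => aL _ ratio.
exists L; split=> //; first exact: lt_le_trans aL.
move=> x y; have [->|xy] := pselect (x = y); first by rewrite !distxx// mulr0.
by have := ratio _ _ xy; rewrite !lee_fin ler_pdivrMr ?dist_gt0// => /andP[].
Qed.

(** Without two distinct points the infimum of ratios is [+oo] and the supremum [-oo], against
    [Lip_minus <= Lip_plus]. *)
Lemma bilip_contraction_pts (f : T -> T) :
  bilip_contraction d f -> exists x0 y0 : T, x0 <> y0.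
Proof.
move=> [_ [mp _]]; apply: contrapT => h; suff r0 : ratios d f = set0.
  by move: mp; rewrite /Lip_minus /Lip_plus r0 ereal_inf0 ereal_sup0.
by apply/seteqP; split=> // z [x [y [xy _]]]; apply: h; exists x, y.
Qed.

Lemma bilip_contractionP (f : T -> T) : bilip_contraction d f ->
  exists a, exists b, [/\ 0 < a, 0 < b < 1,
    forall x y, a * d x y <= d (f x) (f y) &
    forall x y, d (f x) (f y) <= b * d x y].
Proof.
move=> fc; have [x0 [y0 xy0]] := bilip_contraction_pts fc.
have [m0 [_ p1]] := fc.
have ratio x y : x <> y ->
    (Lip_minus d f <= (d (f x) (f y) / d x y)%:E <= Lip_plus d f)%E.
  move=> xy; apply/andP; split.
    by apply: ereal_inf_lbound; exists x, y.
  by apply: ereal_sup_ubound; exists x, y.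
case: (Lip_minus d f) m0 ratio => [a| |]//; last first.
  by move=> _ /(_ _ _ xy0)/andP[].
rewrite lte_fin => a0.
case: (Lip_plus d f) p1 => [b| |]//; last by move=> _ /(_ _ _ xy0)/andP[].
rewrite lte_fin => b1 ratio; exists a, b; split=> //.
- have := ratio _ _ xy0; rewrite !lee_fin b1 andbT => /andP[h1 h2].
  exact: lt_le_trans (le_trans h1 h2).
- move=> x y; have [->|xy] := pselect (x = y); first by rewrite !distxx// mulr0.
  by have := ratio _ _ xy; rewrite !lee_fin ler_pdivlMr ?dist_gt0// => /andP[].
- move=> x y; have [->|xy] := pselect (x = y); first by rewrite !distxx// mulr0.
  by have := ratio _ _ xy; rewrite !lee_fin ler_pdivrMr ?dist_gt0// => /andP[].
Qed.

End LipschitzConstants.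

(** * Geometry of the attractors of a random iterated function system *)

Section RandomIFS.
Context {R : realType} {T : Type} (d : T -> T -> R).
Context {N : nat} (M : 'I_N -> nat) (S : 'I_N -> nat -> T -> T).
Hypotheses (dP : is_metric d) (dK : seq_compact d) (rifs : is_RIFS d M S).
Implicit Types w : nat -> 'I_N.

Lemma RIFS_pts : exists x0 y0 : T, x0 <> y0.
Proof.
have [N0 [M0 Sc]] := rifs.
exact: bilip_contraction_pts (Sc (Ordinal N0) 0%N (M0 _)).
Qed.

Lemma RIFS_uniform_contraction : exists2 b : R, 0 < b < 1 &
  forall i j x y, (j < M i)%N -> d (S i j x) (S i j y) <= b * d x y.
Proof.
have [N0 [M0 Sc]] := rifs.
have [p|b bP] := @choice _ _ (fun (p : 'I_N * nat) b => (p.2 < M p.1)%N -> 0 < b < 1 /\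
    forall x y, d (S p.1 p.2 x) (S p.1 p.2 y) <= b * d x y).
  have [pM|_] := boolP (p.2 < M p.1)%N; last by exists 1.
  by have [a [b [_ b01 _ hb]]] := bilip_contractionP dP (Sc _ _ pM); exists b.
pose A : seq ('I_N * nat) := [seq (i, j) | i <- enum 'I_N, j <- iota 0 (M i)].
have AP i j : (j < M i)%N -> (i, j) \in A.
  by move=> jM; apply/allpairsPdep; exists i, j; rewrite mem_enum mem_iota.
have [_ /allpairsPdep[i [j [_ jM ->]]]|c c0 hc] := @exists_pos_le _ _ A (fun p => 1 - b p).
  have [|/andP[_ b1] _] := bP (i, j); first by rewrite mem_iota add0n in jM.
  by rewrite subr_gt0.
(* [c] is a common gap between the ratios and 1; capping it at 1/2 keeps the new ratio positive. *)
exists (1 - Num.min c 2^-1).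
  have h0 : 0 < Num.min c 2^-1 by rewrite lt_min c0 invr_gt0 ltr0n.
  have h1 : Num.min c 2^-1 <= 2^-1 by rewrite ge_min lexx orbT.
  by apply/andP; split; lra.
move=> i j x y jM; have [_ h] := bP (i, j) jM; rewrite (le_trans (h x y))//.
rewrite ler_wpM2r ?dist_ge0// lerBrDr -lerBrDl.
by rewrite (le_trans _ (hc _ (AP _ _ jM)))// ge_min lexx.
Qed.

Lemma compw_lower_lip w n k (s : seq nat) : s \in words M w n k ->
  exists2 a : R, 0 < a & forall x y, a * d x y <= d (compw S w n s x) (compw S w n s y).
Proof.
elim: k n s => [|k IH] n s.
  by rewrite inE => /eqP ->; exists 1 => // x y; rewrite mul1r.
move=> /mem_wordsS[j [t [jM /IH[a a0 ha] ->]]].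
have [_ [_ Sc]] := rifs; have [c [_ [c0 _ hc _]]] := bilip_contractionP dP (Sc _ _ jM).
exists (c * a) => [|x y]; first exact: mulr_gt0.
by apply: le_trans (hc _ _); rewrite -mulrA ler_pM2l.
Qed.

Lemma compw_inj w n k (s : seq nat) : s \in words M w n k -> injective (compw S w n s).
Proof.
move=> /compw_lower_lip[a a0 ha] x y fxy; apply: contrapT => /(dist_gt0 dP) xy.
by have := ha x y; rewrite fxy (distxx dP) leNgt mulr_gt0.
Qed.

Lemma compw_upper_lip (b : R) : 0 < b ->
  (forall i j x y, (j < M i)%N -> d (S i j x) (S i j y) <= b * d x y) ->
  forall w n k (s : seq nat), s \in words M w n k ->
  forall x y, d (compw S w n s x) (compw S w n s y) <= b ^+ k * d x y.
Proof.
move=> b0 hb w n k s; elim: k n s => [|k IH] n s.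
  by rewrite inE => /eqP -> x y; rewrite mul1r.
move=> /mem_wordsS[j [t [jM /IH ht ->]]] x y.
by rewrite exprS -mulrA (le_trans (hb _ _ _ _ jM))// ler_pM2l.
Qed.

Lemma compw_nonexpanding w n k (s : seq nat) : s \in words M w n k ->
  forall x y, d (compw S w n s x) (compw S w n s y) <= d x y.
Proof.
have [b /andP[b0 b1] hb] := RIFS_uniform_contraction.
move=> /(compw_upper_lip b0 hb) h x y; rewrite (le_trans (h x y))//.
by rewrite ler_piMl ?dist_ge0 ?exprn_ile1 ?(ltW b0) ?(ltW b1).
Qed.

(** A uniform contraction ratio [b] and a bound [D] on all distances bound the diameter by
    [b ^+ m * D], uniformly in [w] and [s]. *)
Lemma cylinder_small (e : R) : 0 < e -> exists k, forall w m (s : seq nat),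
  (k <= m)%N -> s \in words M w 0 m ->
  forall x y, cylinder S w s x -> cylinder S w s y -> d x y < e.
Proof.
move=> e0; have [b /andP[b0 b1] hb] := RIFS_uniform_contraction.
have [t0 _] := RIFS_pts; have [D D0 hD] := seq_compact_bounded dP dK t0.
have : (fun k => b ^+ k) @ \oo --> (0 : R) by apply: cvg_expr; rewrite gtr0_norm.
move=> /cvgrPdist_lt/(_ (e / D)) []; first by rewrite divr_gt0.
move=> k _ hk; exists k => w m s km sw _ _ [x _ <-] [y _ <-].
rewrite (le_lt_trans (compw_upper_lip b0 hb sw _ _))//.
apply: (@le_lt_trans _ _ (b ^+ m * D)); first by rewrite ler_wpM2l// exprn_ge0// ltW.
by have := hk m km; rewrite sub0r normrN ger0_norm ?exprn_ge0 ?(ltW b0)// ltr_pdivlMr.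
Qed.

(** The images of [t0] under the words [sq n] accumulate at some [x]; from index [n] on they lie in
    the cylinder of [sq n], which is closed. *)
Lemma nested_cylinders w (sq : nat -> seq nat) :
  (forall n, sq n \in words M w 0 (size (sq n))) ->
  (forall n, exists t, sq n.+1 = sq n ++ t) ->
  exists x, forall n, cylinder S w (sq n) x.
Proof.
move=> sqw sqS; have [t0 _] := RIFS_pts.
have mono n m : (n <= m)%N -> cylinder S w (sq m) `<=` cylinder S w (sq n).
  move=> /subnKC <-; elim: (m - n)%N => [|k IH]; first by rewrite addn0.
  by rewrite addnS; have [t ->] := sqS (n + k)%N;
  exact: subset_trans (@cylinder_cat _ _ _ _ _ _) IH.
have [phi [x [phile hx]]] := seq_compact_subseq dP dK (fun n => compw S w 0 (sq n) t0).
exists x => n; have [a a0 ha] := compw_lower_lip (sqw n).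
have [||y xy] := closed_image dP dK a0 ltr01 ha (x := x).
- by move=> y z; rewrite mul1r (compw_nonexpanding (sqw n)).
- move=> e /hx[m hm]; pose k := maxn m n.
  have [||y _ yE] := @mono n (phi k) _ (compw S w 0 (sq (phi k)) t0).
  - by rewrite (leq_trans (leq_maxr m n))// phile.
  - by exists t0.
  by exists y; rewrite yE; apply: hm; exact: leq_maxl.
- by exists y.
Qed.

Lemma F_nonempty w : exists x, F M S w x.
Proof.
have [_ [M0 _]] := rifs.
have [n|n|x hx] := @nested_cylinders w (fun n => nseq n 0%N).
- by rewrite size_nseq; exact: nseq0_words.
- by exists [:: 0%N]; rewrite -[[:: _]]/(nseq 1 0%N) -nseqD addn1.
by exists x; apply/(F_level M S w x) => n; exists (nseq n 0%N) => //; exact: nseq0_words.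
Qed.

Lemma F_compw w k (s : seq nat) (x : T) : s \in words M w 0 k ->
  F M S (shiftn k w) x -> F M S w (compw S w 0 s x).
Proof.
(* Levels decrease, so membership in level [k + m] suffices. *)
move=> sw /F_level Fx; apply/F_level => m; apply: (level_le (leq_addl k m)).
have [t /= tw [y _ <-]] := Fx m.
exists (s ++ t) => /=; first by apply: words_cat => //; move: tw; rewrite words_shiftn addn0.
by exists y => //; rewrite compw_cat compw_shiftn (size_words sw) addn0.
Qed.

Lemma F_decomposition w k :
  F M S w = \bigcup_(s in [set s | s \in words M w 0 k]) (compw S w 0 s @` F M S (shiftn k w)).
Proof.
apply/seteqP; split=> [x Fx|_ [s /= sw [x Fx <-]]]; last exact: F_compw sw Fx.
apply: contrapT => nx.
(* Each word fails at some finite level: if [x] had a preimage in every level, injectivity would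
   make these preimages one point of the shifted attractor. Beyond the largest failing level, the
   word of [x] gives a contradiction. *)
have [s|m hm] := @choice _ _ (fun s m => s \in words M w 0 k ->
    ~ (compw S w 0 s @` level M S (shiftn k w) m) x).
  have [sw|_] := boolP (s \in words M w 0 k); last by exists 0%N.
  apply: contrapT => /forallNP h; apply: nx; exists s => //.
  have {}h m : (compw S w 0 s @` level M S (shiftn k w) m) x.
    by apply: contrapT => nm; apply: (h m).
  have [y _ yx] := h 0%N; exists y => //; apply/F_level => m.
  by have [z zm zx] := h m; rewrite -(compw_inj sw (etrans zx (esym yx))).
pose K := \max_(s <- words M w 0 k) m s.
have [r rw [z _ zx]] := (F_level M S w x).1 Fx (k + K)%N.
have [s [t [sw tw rE]]] := words_split rw.
apply: (hm _ sw); exists (compw S w k t z).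
  apply: (@level_le _ _ _ _ _ _ K); first by exact: leq_bigmax_seq.
  by exists t => /=; [rewrite words_shiftn addn0 | exists z => //; rewrite compw_shiftn addn0].
by rewrite -zx rE compw_cat (size_words sw).
Qed.

(** A long common prefix gives the same small cylinders of length [k], and each of them meets
    [F M S w']. *)
Lemma F_agree_close (e : R) : 0 < e -> exists k, forall w w', agree k w w' ->
  forall x, F M S w x -> exists2 y, F M S w' y & d x y < e.
Proof.
move=> /cylinder_small[k hk]; exists k => w w' ww' x /F_level/(_ k)[s /= sw xs].
have [y Fy] := F_nonempty (shiftn k w').
have sw' : s \in words M w' 0 k by rewrite -(words_agree M ww').
exists (compw S w' 0 s y); first exact: F_compw sw' Fy.
apply: (hk w k s) => //; exists y => //.
by rewrite (@compw_agree _ _ _ w w')// (size_words sw).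
Qed.

Lemma packing_measure_F_le (p : R) w k :
  (packing_measure d p (F M S w) <=
   \sum_(s <- words M w 0 k)
     poweR (Lip_plus d (compw S w 0 s)) p * packing_measure d p (F M S (shiftn k w)))%E.
Proof.
have [t0 [t1 t01]] := RIFS_pts.
rewrite (F_decomposition w k); apply: le_trans (packing_measure_bigcup_seq _ _ t0 _ _) _.
rewrite big_seq [leRHS]big_seq; apply: lee_sum => s sw.
have [a a0 ha] := compw_lower_lip sw.
have [|L [L0 -> hL]] := Lip_plus_fin dP (b := 1) t01 a0 ha.
  by move=> x y; rewrite mul1r (compw_nonexpanding sw).
by rewrite poweR_EFin; exact: packing_measure_image_le.
Qed.

(** The coarse bound, with Lipschitz constant 1 for every word; it handles an arbitrary prefix whose
    sum need not be small. *)
Lemma packing_measure_F_le_size (p : R) w k :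
  (packing_measure d p (F M S w) <=
   (size (words M w 0 k))%:R%:E * packing_measure d p (F M S (shiftn k w)))%E.
Proof.
have [t0 [t1 t01]] := RIFS_pts.
rewrite (F_decomposition w k); apply: le_trans (packing_measure_bigcup_seq _ _ t0 _ _) _.
set P := packing_measure d p _.
apply: (@le_trans _ _ (\sum_(s <- words M w 0 k) P)%E).
  rewrite big_seq [leRHS]big_seq; apply: lee_sum => s sw.
  rewrite [leRHS](_ : _ = ((1 `^ p)%:E * P)%E); last by rewrite powR1 mul1e.
  apply: packing_measure_image_le => // x y.
  by rewrite mul1r (compw_nonexpanding sw).
elim: (words M w 0 k) => [|s r IH]; first by rewrite big_nil mul0e.
rewrite big_cons /= -natr1 EFinD ge0_muleDl// mul1e addeC.
by rewrite leeD2r.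
Qed.

End RandomIFS.

(** * Residual sets described by common prefixes *)

Section Residual.
Context {R : realType} {N : nat}.
Implicit Types u v w : nat -> 'I_N.

Lemma dOmega_lt_agree k u v : dOmega R u v < 2 ^- k -> agree k u v.
Proof.
move=> uv i ik; apply: contrapT => /eqP uvi.
have : (2 : R) ^- i.+1 <= dOmega R u v.
  apply: ub_le_sup; last by exists i.
  by exists 1 => _ [n _ <-]; rewrite invf_le1 ?exprn_gt0// exprn_ege1// ler1n.
rewrite leNgt => /negP; apply; rewrite (lt_le_trans uv)//.
by rewrite lef_pV2 ?posrE ?exprn_gt0// ler_eXn2l// ltr1n.
Qed.

Lemma agree_dOmega k u v : agree k u v -> dOmega R u v <= 2 ^- k.
Proof.
move=> uv; rewrite /dOmega; set A := [set _ | _ in _].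
(* [A] is empty when the two sequences coincide, and then its supremum is 0. *)
have [->|/set0P A0] := eqVneq A set0; first by rewrite sup0 invr_ge0 exprn_ge0.
apply: ge_sup => // _ [n /= uvn <-].
have kn : (k <= n)%N by rewrite leqNgt; apply: contra uvn => /uv ->.
by rewrite lef_pV2 ?posrE ?exprn_gt0// ler_eXn2l ?ltr1n// ltnW.
Qed.

Lemma Omega_residual_countable (J : countType) (G : J -> set (nat -> 'I_N))
    (A : set (nat -> 'I_N)) :
  (forall i u, G i u -> exists k, forall v, agree k u v -> G i v) ->
  (forall i u k, exists2 v, agree k u v & G i v) ->
  (forall u, (forall i, G i u) -> A u) ->
  Omega_residual R A.
Proof.
move=> Gopen Gdense GA.
(* Numbers that encode no index receive the whole space. *)
exists (fun n => if unpickle n is Some i then G i else setT); split; last first.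
  by move=> u Gu; apply: GA => i; have := Gu (pickle i) I; rewrite pickleK.
move=> n; case: unpickle => [i|]; last first.
  split=> [u _|u e e0]; first by exists 1.
  exists u; split=> //; rewrite /dOmega (_ : [set _ | _ in _] = set0) ?sup0//.
  by apply/seteqP; split=> // z [k /=]; rewrite eqxx.
split=> [u /Gopen[k hk]|u e e0].
  by exists (2 ^- k); rewrite ?invr_gt0 ?exprn_gt0// => v /dOmega_lt_agree/hk.
have /cvgrPdist_lt/(_ _ e0)[k _ hk] : (fun k => (2^-1 : R) ^+ k) @ \oo --> (0 : R).
  by apply: cvg_expr; rewrite gtr0_norm ?invr_gt0// invf_lt1// ltr1n.
have [v uv Gv] := Gdense i u k; exists v; split=> //.
rewrite (le_lt_trans (agree_dOmega uv))// -exprVn.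
by have := hk k (leqnn k); rewrite sub0r normrN ger0_norm// exprn_ge0// invr_ge0.
Qed.

End Residual.

(** Supplies the density witnesses: points near [u] with a prescribed tail [x]. *)
Definition splice {X : Type} (k : nat) (u x : nat -> X) : nat -> X :=
  fun i => if (i < k)%N then u i else x (i - k)%N.

Lemma agree_splice {X : Type} (k m : nat) (u x : nat -> X) :
  (m <= k)%N -> agree m u (splice k u x).
Proof. by move=> mk i im; rewrite /splice (leq_trans im mk). Qed.

Lemma shiftn_splice {X : Type} (k : nat) (u x : nat -> X) : shiftn k (splice k u x) = x.
Proof.
by apply/funext => i; rewrite /shiftn /splice ltnNge leq_addr/= ssrnat.addKn.
Qed.

Lemma agree_shiftn {X : Type} (k m : nat) (u v : nat -> X) :
  agree (k + m) u v -> agree m (shiftn k u) (shiftn k v).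
Proof. by move=> uv i im; apply: uv; rewrite ltn_add2l. Qed.

Lemma shiftnD {X : Type} (k m : nat) (u : nat -> X) : shiftn m (shiftn k u) = shiftn (k + m) u.
Proof. by apply/funext => i; rewrite /shiftn addnA. Qed.

(** * Packing measure of typical attractors *)

Section TypicalPacking.
Context {R : realType} {T : Type} (d : T -> T -> R).
Context {N : nat} (M : 'I_N -> nat) (S : 'I_N -> nat -> T -> T) (p : R).
Hypotheses (dP : is_metric d) (dK : seq_compact d) (rifs : is_RIFS d M S).
Hypothesis p0 : 0 <= p.
Implicit Types w : nat -> 'I_N.

(* Baire's argument on nested cylinders: a set of finite premeasure is not dense
   in any cylinder, so the n-th set of a cover by such sets misses some cylinder
   inside the previously chosen one. *)
Lemma packing_measure_F_pinfty w :
  (forall k, packing_premeasure d p (F M S (shiftn k w)) = +oo%E) ->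
  packing_measure d p (F M S w) = +oo%E.
Proof.
move=> Foo; have [t0 _] := RIFS_pts rifs.
apply/eqP; rewrite -leye_eq; apply: le_ereal_inf_tmp => _ [E [FE ->]].
have [[n En]|/forallNP Efin] := pselect (exists n, packing_premeasure d p (E n) = +oo%E).
  rewrite (esumID [set n]) => [|i _]; last exact: packing_premeasure_ge0.
  rewrite setTI esum_set1 ?packing_premeasure_ge0// En leeDl// esum_ge0// => i _.
  exact: packing_premeasure_ge0.
have [q|ext extP] := @choice _ _ (fun (q : nat * seq nat) t =>
    q.2 \in words M w 0 (size q.2) ->
    [/\ q.2 ++ t \in words M w 0 (size (q.2 ++ t)), (0 < size t)%N &
        forall x, cylinder S w (q.2 ++ t) x -> ~ E q.1 x]).
  case: q => n s /=; have [sw|_] := boolP (s \in _); last by exists [::].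
  pose k := size s; have [a a0 ha] := compw_lower_lip dP rifs sw.
  (* Otherwise [E n] would approximate every point of a copy of infinite premeasure, and would have
     infinite premeasure itself. *)
  have [y [e [Fy [e0 ye]]]] : exists y e, F M S (shiftn k w) y /\
      (0 < e /\ forall z, E n z -> e <= d (compw S w 0 s y) z).
    apply: contrapT => nye; apply: (Efin n); apply/eqP; rewrite -leye_eq.
    apply: (@le_trans _ _ (packing_premeasure d p (compw S w 0 s @` F M S (shiftn k w)))).
      apply: le_trans (packing_premeasure_image_ge dP p a0 ha (E := F M S (shiftn k w)) _).
        by rewrite Foo gt0_muley// lte_fin powR_gt0// divr_gt0.
      by move=> x Fx; exists x.
    apply: (packing_premeasure_adherence dP p0 t0) => _ e [y Fy <-] e0.
    apply: contrapT => nz; apply: nye; exists y, e; split=> //; split=> // z Ez.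
    by rewrite leNgt; apply/negP => yz; apply: nz; exists z.
  have [m hm] := cylinder_small dP dK rifs e0.
  (* Length [m.+1] rather than [m] makes the extension nonempty. *)
  have [t tw [z _ zy]] := (F_level M S _ y).1 Fy m.+1.
  have stw : s ++ t \in words M w 0 (k + m.+1).
    by apply: words_cat => //; move: tw; rewrite /mkset words_shiftn addn0.
  exists t => _; rewrite (size_words stw) (size_words tw); split=> // x sx Ex.
  have := ye _ Ex; rewrite leNgt => /negP; apply.
  apply: hm stw _ _ _ sx; first by rewrite (leq_trans (leqnSn m))// leq_addl.
  by exists z => //; rewrite compw_cat -zy compw_shiftn addn0.
pose fix sq n : seq nat := if n is m.+1 then sq m ++ ext (m, sq m) else [::].
have sqw n : sq n \in words M w 0 (size (sq n)).
  by elim: n => // n IH /=; have [] := extP (n, sq n) IH.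
have [|x hx] := nested_cylinders dP dK rifs sqw; first by move=> n; exists (ext (n, sq n)).
have size_sq n : (n <= size (sq n))%N.
  elim: n => // n IH /=; have [_ ? _] := extP (n, sq n) (sqw n).
  by rewrite size_cat -addn1 leq_add.
have /FE[n _ Enx] : F M S w x.
  by apply/F_level => n; apply: (level_le (size_sq n)); exists (sq n) => //; exact: sqw.
by have [_ _ /(_ x (hx n.+1))] := extP (n, sq n) (sqw n).
Qed.

Lemma typical_packing_measure_pinfty :
  ereal_sup [set packing_measure d p (F M S u) | u in [set: nat -> 'I_N]] = +oo%E ->
  typical R (fun w => packing_measure d p (F M S w) = +oo%E).
Proof.
move=> supoo; have [t0 _] := RIFS_pts rifs.
apply: (@Omega_residual_countable _ _ (nat * nat)%type (fun nk => [set w |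
  (nk.1%:R%:E < packing_premeasure_delta d p nk.1.+1%:R^-1 (F M S (shiftn nk.2 w)))%E])).
- move=> [n k] u /= /(packing_premeasure_delta_lsc dP p0 (ler0n _ _))[e e0 he].
  have [m hm] := F_agree_close dP dK rifs e0; exists (k + m)%N => v /agree_shiftn uv.
  by apply: he => x; exact: hm.
- move=> [n k] u m /=.
  have [_ [M0 _]] := rifs.
  have sw := nseq0_words (shiftn k u) 0 m M0; set s := nseq m 0%N in sw.
  have [a a0 ha] := compw_lower_lip dP rifs sw.
  (* The copy under [s] retains at least this fraction of the measure, so [x] is chosen with measure
     above [n] divided by it. *)
  have ca0 : 0 < (a / 2) `^ p by rewrite powR_gt0// divr_gt0.
  have : ((((a / 2) `^ p)^-1 * n%:R)%:E <
      ereal_sup [set packing_measure d p (F M S u) | u in [set: nat -> 'I_N]])%E.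
    by rewrite supoo ltry.
  move=> /ereal_sup_gt[_ [x _ <-]]; rewrite EFinM lte_pdivrMl// => nx.
  (* The tail starts at [k + m], so that after [k] shifts the attractor of [x] appears behind the
     word [s] of length [m]. *)
  exists (splice (k + m) u x); first by apply: agree_splice; exact: leq_addl.
  set w := splice _ _ _.
  have uw : agree m (shiftn k u) (shiftn k w) by exact/agree_shiftn/agree_splice.
  have cE : compw S (shiftn k u) 0 s = compw S (shiftn k w) 0 s.
    by apply: compw_agree; rewrite size_nseq.
  apply: (lt_le_trans nx).
  apply: (@le_trans _ _ (packing_measure d p (F M S (shiftn k w)))).
    apply: le_trans (packing_measure_image_ge dP p t0 a0 ha _) _.
    apply: le_packing_measure => _ [y Fy <-]; rewrite cE.
    apply: (F_compw (k := m)); first by rewrite -(words_agree M uw).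
    by rewrite shiftnD shiftn_splice.
  apply: (le_trans (packing_measure_le_premeasure _ _ t0 _)).
  by apply: ereal_inf_lbound; exists (n.+1%:R^-1) => //=; rewrite invr_gt0.
- move=> u Gu; apply: packing_measure_F_pinfty => k.
  by apply/packing_premeasure_pinftyP => n; exact: Gu (n, k).
Qed.

Lemma typical_packing_measure0 (v : nat -> 'I_N) :
  (fun k => (\sum_(s <- words M v 0 k) poweR (Lip_plus d (compw S v 0 s)) p)%E)
    @ \oo --> 0%E ->
  (ereal_sup [set packing_measure d p (F M S u) | u in [set: nat -> 'I_N]] < +oo)%E ->
  typical R (fun w => packing_measure d p (F M S w) = 0%E).
Proof.
move=> cv0 supfin; have [t0 _] := RIFS_pts rifs.
have P0 w : (0 <= packing_measure d p (F M S w))%E by exact: packing_measure_ge0.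
have [C C0 PC] : exists2 C : R, 0 <= C & forall w, (packing_measure d p (F M S w) <= C%:E)%E.
  have Psup w := ereal_sup_ubound
    (imageT (fun w => packing_measure d p (F M S w)) w).
  case: (ereal_sup _) supfin Psup => [C| |]// _ PC; last first.
    by have := le_trans (P0 v) (PC v).
  by exists C => //; rewrite -lee_fin (le_trans (P0 v)).
(* Asking for the bound on a whole prefix neighbourhood makes each set open by construction. *)
apply: (@Omega_residual_countable _ _ nat (fun n => [set w | exists k, forall w',
  agree k w w' -> (packing_measure d p (F M S w') < n.+1%:R^-1%:E)%E])).
- move=> n u [k hk]; exists k => w uw; exists k => w' ww'.
  by apply: hk => i ik; rewrite uw// ww'.
- move=> n u m; pose W : R := (size (words M u 0 m))%:R.
  (* Chosen so that [W * (e * C)] is below [n.+1%:R^-1]; the added 1 keeps the denominator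
     positive. *)
  pose e := n.+1%:R^-1 / (W * C + 1).
  have WC : 0 < W * C + 1 by rewrite ltr_wpDl// mulr_ge0.
  have e0 : 0 < e by rewrite divr_gt0// invr_gt0.
  have [k _ hk] : \forall k \near \oo,
      (\sum_(s <- words M v 0 k) poweR (Lip_plus d (compw S v 0 s)) p < e%:E)%E.
    apply: (cv0 [set y | (y < e%:E)%E]); apply: open_nbhs_nbhs; split=> //=.
      exact: open_ereal_lt_ereal.
  exists (splice m u v); first exact: agree_splice.
  exists (m + k)%N => w uvw.
  have uw : agree m u w.
    by move=> i im; rewrite -uvw ?(ltn_addr _ im)//; exact: agree_splice im.
  have vw : agree k v (shiftn m w).
    by rewrite -[v in agree _ v](shiftn_splice m u); exact: agree_shiftn.
  apply: (le_lt_trans (packing_measure_F_le_size dP rifs p w m)).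
  rewrite -(words_agree M uw).
  apply: (@le_lt_trans _ _ (W%:E * (e%:E * C%:E))%E); last first.
    rewrite -!EFinM lte_fin mulrCA /e mulrAC ltr_pdivrMr// ltr_pM2l ?invr_gt0//.
    by rewrite ltrDl.
  rewrite lee_wpmul2l ?lee_fin//.
  (* The tail of [w] begins with [k] letters of [v], so its weights are those of the small sum for
     [v]. *)
  apply: (le_trans (packing_measure_F_le dP rifs p (shiftn m w) k)).
  apply: (@le_trans _ _ ((\sum_(s <- words M v 0 k)
      poweR (Lip_plus d (compw S v 0 s)) p) * C%:E)%E); last first.
    by rewrite lee_wpmul2r ?lee_fin// ltW// hk/=.
  rewrite ge0_sume_distrl; last by move=> s _; exact: poweR_ge0.
  rewrite -(words_agree M vw) big_seq [leRHS]big_seq; apply: lee_sum => s sw.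
  rewrite -(@compw_agree _ _ _ v) ?(size_words sw)//.
  by rewrite lee_wpmul2l ?poweR_ge0.
- move=> u Gu; apply/eqP; rewrite eq_le P0 andbT.
  apply/lee_addgt0Pr => e e0; rewrite add0e.
  have [k /(_ u)uk] := Gu (Num.truncn e^-1).
  apply: (le_trans (ltW (uk _))); first by [].
  rewrite lee_fin -[leRHS]invrK lef_pV2 ?posrE ?invr_gt0//.
  exact/ltW/truncnS_gt.
Qed.

End TypicalPacking.

Unset Implicit Arguments.

Theorem theorem2p3 (R : realType) (T : Type) (d : T -> T -> R)
  (N : nat) (M : 'I_N -> nat) (S : 'I_N -> nat -> T -> T) (p : R) :
  is_metric d -> seq_compact d ->
  is_RIFS d M S ->
  p%:E = ereal_sup [set packing_dim d (F M S u) | u in [set: nat -> 'I_N]] ->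
  (exists v : nat -> 'I_N,
     (fun k => (\sum_(s <- words M v 0 k) poweR (Lip_plus d (compw S v 0 s)) p)%E)
       @ \oo --> 0%E) ->
  (ereal_sup [set packing_measure d p (F M S u) | u in [set: nat -> 'I_N]] = +oo%E ->
     typical R (fun w => packing_measure d p (F M S w) = +oo%E)) /\
  ((ereal_sup [set packing_measure d p (F M S u) | u in [set: nat -> 'I_N]] < +oo)%E ->
     typical R (fun w => packing_measure d p (F M S w) = 0%E)).
Proof.
move=> dP dK rifs pE [v cv0].
have p0 : 0 <= p.
  (* A packing dimension is an infimum of nonnegative exponents, and [v] provides one below the
     supremum. *)
  rewrite -lee_fin pE; apply: (@le_trans _ _ (packing_dim d (F M S v))).
    by apply: le_ereal_inf_tmp => _ [t [t0 _] <-]; rewrite lee_fin.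
  by apply: ereal_sup_ubound; exists v.
split; first exact: typical_packing_measure_pinfty.
exact: typical_packing_measure0 cv0.
Qed.
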